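(* Let $p,n\in\mathbb{N}$ with $p,n\ge1$, $r\in\mathbb{N}$ with $r\le p$, and assume $n\ge\max\{p+1,\;p+\lfloor p/2\rfloor\}$. Then $$X^{p,r,2}=\Big(\frac{2n+1}{2}\Big)^{2r-1}\big(T_n^{\bm\alpha}+H_n^{\bm\alpha,2,1}\big),$$ where $\alpha_k=(-1)^r\mathcal{N}_{2p+1}^{(2r)}(p+1-k)$, $k=0,\dots,p$.
   Context: Cardinal B-spline: $\mathcal{N}_0(t)=1$ for $t\in[0,1)$, $0$ otherwise; $\mathcal{N}_p(t)=\frac{t}{p}\mathcal{N}_{p-1}(t)+\frac{p+1-t}{p}\mathcal{N}_{p-1}(t-1)$, $p\ge1$ (support $[0,p+1]$, $C^{p-1}$). Mixed basis: for $c\in\mathbb{R}$ put $D_c(x)=\mathcal{N}_p\big(\tfrac{2n+1}{2}x-c+\tfrac{p+1}{2}\big)$ (B-spline centred at $2c/(2n+1)$), and for $i=1,\dots,n$, $x\in[0,1]$, $$N^p_{i,2}(x)=\sum_{m\in\mathbb{Z}}(-1)^m\Big(D_{i+m(2n+1)}(x)-D_{-i+m(2n+1)}(x)\Big).$$ These form a basis of the $C^{p-1}$ splines of degree $p$ with breakpoints $2k/(2n+1)$ ($p$ odd) or $(2k+1)/(2n+1)$ ($p$ even) whose even-order derivatives ($\le p$) vanish at $0$ and odd-order derivatives ($\le p$) vanish at $1$. $X^{p,r,2}_{i,j}=\int_0^1(N^p_{i,2})^{(r)}(N^p_{j,2})^{(r)}\,\mathrm{d}x$. With $\alpha_k=0$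 for $k>p$: $(T_n^{\bm\alpha})_{i,j}=\alpha_{|i-j|}$ and $(H_n^{\bm\alpha,2,1})_{i,j}=-\alpha_{i+j}+\alpha_{2n+1-i-j}$. *)

(* Defs.v *)
From HB Require Import structures.
From mathcomp Require Import all_boot all_order all_algebra.
From mathcomp Require Import all_classical all_reals all_analysis.
Set Implicit Arguments. Unset Strict Implicit. Unset Printing Implicit Defensive.
Import Order.TTheory GRing.Theory Num.Theory.
Import numFieldNormedType.Exports.
Local Open Scope classical_set_scope.
Local Open Scope ring_scope.

Fixpoint bspline {R : realType} (p : nat) (t : R) : R :=
  match p with
  | 0%N => if (0 <= t) && (t < 1) then 1 else 0
  | q.+1 => t / q.+1%:R * bspline q t
            + (q.+2%:R - t) / q.+1%:R * bspline q (t - 1)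
  end.

Definition Dc {R : realType} (p n : nat) (c : R) (x : R) : R :=
  bspline p ((2 * n + 1)%:R / 2 * x - c + p.+1%:R / 2).

Definition sumZ {R : realType} (f : int -> R) : R :=
  lim ((fun N : nat => \sum_(0 <= k < (2 * N).+1) f (k%:Z - N%:Z)) @ \oo).

(* Mixed basis function N^p_{i,2} (extended to all of R by the same formula). *)
Definition Nmix {R : realType} (p n i : nat) (x : R) : R :=
  sumZ (fun m : int =>
    (-1) ^ m * (Dc p n ((i%:Z + m * (2 * n + 1)%:Z)%:~R) x
               - Dc p n ((- i%:Z + m * (2 * n + 1)%:Z)%:~R) x)).

Definition Xmat {R : realType} (p r n i j : nat) : R :=
  \int[@lebesgue_measure R]_(x in `[0%R, 1%R])
     (derive1n r (@Nmix R p n i) x * derive1n r (@Nmix R p n j) x).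

Definition alpha {R : realType} (p r k : nat) : R :=
  if (k <= p)%N then
    (-1) ^+ r * derive1n (2 * r) (@bspline R (2 * p + 1)) (p.+1%:R - k%:R)
  else 0.

(* (T_n^alpha)_{i,j} = alpha_{|i-j|}, 1-based indices *)
Definition Tmat {R : realType} (p r n i j : nat) : R :=
  @alpha R p r (if (i <= j)%N then j - i else i - j)%N.

(* (H_n^{alpha,2,1})_{i,j} = -alpha_{i+j} + alpha_{2n+1-i-j}, 1-based *)
Definition Hmat {R : realType} (p r n i j : nat) : R :=
  - @alpha R p r (i + j) + @alpha R p r (2 * n + 1 - i - j).

(* Main.v *)
Require Import Defs.
From HB Require Import structures.
From mathcomp Require Import all_boot all_order all_algebra.
From mathcomp Require Import all_classical all_reals all_analysis measurable_realfun.
From mathcomp Require Import ring lra zify.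
Set Implicit Arguments. Unset Strict Implicit. Unset Printing Implicit Defensive.
Import Order.TTheory GRing.Theory Num.Theory.
Import numFieldNormedType.Exports.
Local Open Scope classical_set_scope.
Local Open Scope ring_scope.

(* Write U_q(t) = t_+^q / q! and nabla f (t) = f t - f (t - 1).  Then
   N_p = nabla^(p+1) U_p, so N_p^(r) = w := nabla^(p+1) U_(p-r) away from the knots
   (everywhere if r < p).  Since U_q * U_q = U_(2q+1) for convolution and w is
   symmetric up to the sign (-1)^r about (p+1)/2, the integral over R of two integer
   translates of w is (-1)^r nabla^(2p+2) U_(2(p-r)+1), that is, +- N_(2p+1)^(2r).
   On [0,1] only the splines centred at i, -i and M - i (M = 2n+1) contribute to N_i.
   After the scaling y = M x / 2, the reflections y -> -y and y -> M - y exchange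
   these centres, so the nine products over [0, M/2] glue to three integrals over R;
   the products of the centres -i and M - j vanish. *)

(** * Backward differences of truncated powers, and B-splines *)

Section TruncatedPowers.
Context {R : realType}.
Implicit Types (f g : R -> R) (t c : R) (m p q : nat).

Definition nabla f : R -> R := fun t => f t - f (t - 1).

(* truncpow 0 is 1 at 0, in agreement with the half-open support of N_0. *)
Definition truncpow q : R -> R := fun t => if 0 <= t then t ^+ q / q`!%:R else 0.

Lemma iter_nabla_eq m f g : f =1 g -> iter m nabla f =1 iter m nabla g.
Proof. by move=> fg; have -> : f = g by exact/funext. Qed.

Lemma iter_nablaZ m f c t :
  iter m nabla (fun x => c * f x) t = c * iter m nabla f t.
Proof. by elim: m t => [//|m IH] t /=; rewrite /nabla !IH mulrBr. Qed.

Lemma iter_nablaB m f g t :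
  iter m nabla (fun x => f x - g x) t = iter m nabla f t - iter m nabla g t.
Proof. by elim: m t => [//|m IH] t /=; rewrite /nabla !IH; ring. Qed.

(** Discrete Leibniz rule: [nabla] maps x to 1, so at most one of the m differences falls on the
    factor x, and f is then sampled one step back. *)
Lemma iter_nabla_mulid m f t :
  iter m nabla (fun x => x * f x) t =
  t * iter m nabla f t + m%:R * iter m.-1 nabla f (t - 1).
Proof.
elim: m t => [|m IH] t; first by rewrite /= mul0r addr0.
rewrite [LHS]/= /nabla !IH; case: m IH => [|m] _; first by rewrite /= /nabla; ring.
by rewrite /= /nabla -![in RHS]natr1; ring.
Qed.

(** Differences lower the degree: with x^(q+1) = x * x^q, both Leibniz terms still carry more than q
    differences of x^q. *)
Lemma iter_nabla_exprn m q t : (q < m)%N -> iter m nabla (fun x => x ^+ q) t = 0.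
Proof.
elim: q m t => [|q IH] [//|m] t qm.
  rewrite iterSr (_ : nabla _ = (fun=> 0)); last first.
    by apply/funext => x; rewrite /nabla !expr0 subrr.
  by elim: m t {qm} => //= m IH t; rewrite /nabla !IH subrr.
rewrite (@iter_nabla_eq _ _ (fun x => x * x ^+ q)); last first.
  by move=> x; rewrite exprS.
by rewrite iter_nabla_mulid !IH ?mulr0 ?addr0 //= ltnW.
Qed.

Lemma iter_nabla_reflect m f t :
  iter m nabla (fun x => f (- x)) t = (-1) ^+ m * iter m nabla f (m%:R - t).
Proof.
elim: m t => [|m IH] t; first by rewrite /= mul1r sub0r.
rewrite /= {1}/nabla !IH /nabla exprS -natr1.
have -> : m%:R + 1 - t - 1 = m%:R - t by ring.
have -> : m%:R - (t - 1) = m%:R + 1 - t by ring.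
by ring.
Qed.

Lemma eq_iter_nabla_below m f g c :
  (forall x, x < c -> f x = g x) ->
  forall x, x < c -> iter m nabla f x = iter m nabla g x.
Proof.
move=> fg; elim: m => [//|m IH] x xc /=; rewrite /nabla !IH //.
by rewrite ltrBlDr (lt_trans xc) // ltrDl.
Qed.

Lemma eq_iter_nabla_above m f g c :
  (forall x, c <= x -> f x = g x) ->
  forall x, c + m%:R <= x -> iter m nabla f x = iter m nabla g x.
Proof.
move=> fg; elim: m => [|m IH] x; first by rewrite addr0; exact: fg.
by rewrite -natr1 => xc /=; rewrite /nabla !IH //; lra.
Qed.

Lemma truncpow_lt0 q t : t < 0 -> truncpow q t = 0.
Proof. by rewrite /truncpow ltNge; case: ifP. Qed.

Lemma truncpow_le0 q t : t <= 0 -> truncpow q.+1 t = 0.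
Proof.
rewrite le_eqVlt => /orP[/eqP->|]; last exact: truncpow_lt0.
by rewrite /truncpow lexx expr0n mul0r.
Qed.

Lemma mulid_truncpow q t : t * truncpow q t = q.+1%:R * truncpow q.+1 t.
Proof.
rewrite /truncpow; case: ifP => _; last by rewrite !mulr0.
have f0 : q`!%:R != 0 :> R by rewrite pnatr_eq0 -lt0n fact_gt0.
have q0 : q.+1%:R != 0 :> R by [].
by rewrite factS natrM exprS invfM [in RHS]mulrCA mulVKf // mulrA.
Qed.

(* Both sides satisfy the Cox-de Boor recursion; for the right-hand side this is
   the Leibniz rule [iter_nabla_mulid] applied to x * x_+^q. *)
Lemma bspline_truncpow p t : bspline p t = iter p.+1 nabla (truncpow p) t.
Proof.
elim: p t => [|p IH] t.
  rewrite /= /nabla /truncpow !expr0 fact0 divr1 subr_ge0.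
  by case: (leP 0 t) => t0; case: (leP 1 t) => t1 //=; rewrite ?subrr ?subr0 //; lra.
rewrite [LHS]/= !IH.
set A := iter p.+1 nabla _ _; set B := iter p.+1 nabla _ _.
have := iter_nabla_mulid p.+2 (truncpow p) t.
rewrite (iter_nabla_eq _ (mulid_truncpow p)) iter_nablaZ -pred_Sn -/B.
have -> : iter p.+2 nabla (truncpow p) t = A - B by [].
have p0 : p.+1%:R != 0 :> R by [].
move=> /(canRL (mulKf p0)) ->.
by field; rewrite nat1r.
Qed.

Lemma bspline_lt0 p t : t < 0 -> bspline p t = 0.
Proof.
elim: p t => [|p IH] t t0 /=; first by rewrite leNgt t0.
by rewrite !IH ?mulr0 ?addr0 //; lra.
Qed.

Lemma bspline_ge p t : p.+1%:R <= t -> bspline p t = 0.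
Proof.
elim: p t => [|p IH] t; first by rewrite /= => t1; rewrite ltNge t1 andbF.
by rewrite -natr1 => pt /=; rewrite !IH ?mulr0 ?addr0 //; lra.
Qed.

Lemma iter_nabla_truncpow_lt0 m q t : t < 0 -> iter m nabla (truncpow q) t = 0.
Proof.
move=> t0; rewrite (@eq_iter_nabla_below _ _ (fun x => 0 * x) 0) //.
  by rewrite iter_nablaZ mul0r.
by move=> x x0; rewrite truncpow_lt0 // mul0r.
Qed.

(** The endpoint t = 0, which needs positive degree, is the case k = p + 1 of the convention alpha_k
    = 0. *)
Lemma iter_nabla_truncpow_le0 m q t :
  t <= 0 -> iter m nabla (truncpow q.+1) t = 0.
Proof.
elim: m t => [|m IH] t t0; first exact: truncpow_le0.
by rewrite /= /nabla !IH ?subrr //; lra.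
Qed.

(** Past m all sample points t - k with k <= m are nonnegative, and there the truncated power is a
    polynomial of degree q < m. *)
Lemma iter_nabla_truncpow_ge m q t :
  (q < m)%N -> m%:R <= t -> iter m nabla (truncpow q) t = 0.
Proof.
move=> qm mt.
rewrite (@eq_iter_nabla_above _ _ (fun x => q`!%:R^-1 * x ^+ q) 0) ?add0r //.
  by rewrite iter_nablaZ iter_nabla_exprn ?mulr0.
by move=> x x0; rewrite /truncpow x0 mulrC.
Qed.

(** Exactly one of t and -t is positive. At t = 0 the identity fails for q = 0, since [truncpow 0 0]
    is 1. *)
Lemma truncpow_opp q t : t != 0 ->
  truncpow q (- t) = (-1) ^+ q * (q`!%:R^-1 * t ^+ q - truncpow q t).
Proof.
move=> t0; rewrite /truncpow oppr_ge0.
case: (ltrgtP t 0) t0 => // t0 _.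
  by rewrite subr0 (exprNn t) -mulrA [in RHS](mulrC q`!%:R^-1).
by rewrite [q`!%:R^-1 * _]mulrC subrr mulr0.
Qed.

Lemma eq_iter_nabla_off m f g (S : set R) t :
  (forall x, ~ S x -> f x = g x) -> (forall k, (k <= m)%N -> ~ S (t - k%:R)) ->
  iter m nabla f t = iter m nabla g t.
Proof.
move=> fg; elim: m t => [|m IH] t St; first by have /fg := St 0%N (leqnn _); rewrite subr0.
rewrite /= /nabla !IH // => k km.
  by have := St k.+1 km; rewrite -natr1 opprD [- _ - 1]addrC addrA.
by apply: St; exact: leqW.
Qed.

(** By [truncpow_opp], reflection yields, up to sign, a polynomial of degree q < m minus the
    truncated power; the differences kill the polynomial. At the integers 0 to m a sample point
    would hit 0. *)
Lemma iter_nabla_truncpow_sym m q t :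
  (q < m)%N -> (forall k, (k <= m)%N -> t != k%:R) ->
  iter m nabla (truncpow q) (m%:R - t) =
  (-1) ^+ (m + q).+1 * iter m nabla (truncpow q) t.
Proof.
move=> qm tk; have := iter_nabla_reflect m (truncpow q) t.
rewrite (@eq_iter_nabla_off _ _ (fun x => (-1) ^+ q * (q`!%:R^-1 * x ^+ q - truncpow q x)) [set 0]).
- rewrite iter_nablaZ iter_nablaB iter_nablaZ iter_nabla_exprn // mulr0 sub0r.
  move=> /(congr1 (fun x => (-1) ^+ m * x)).
  rewrite [in RHS]mulrA -expr2 sqrr_sign mul1r => <-.
  by rewrite exprS exprD; ring.
- by move=> x /eqP x0; exact: truncpow_opp.
- by move=> k km /= /eqP; rewrite subr_eq0; apply/negP/tk.
Qed.

End TruncatedPowers.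

(** * Iterated derivatives of truncated powers and of their differences *)

Section DerivativeTowers.
Context {R : realType}.
Implicit Types (F G : nat -> R -> R) (h c x : R) (m p q s : nat).

Lemma is_derive_powfact q x :
  is_derive x 1 (fun t : R => t ^+ q.+1 / q.+1`!%:R) (x ^+ q / q`!%:R).
Proof.
have -> : (fun t : R => t ^+ q.+1 / q.+1`!%:R) = q.+1`!%:R^-1 *: (id ^+ q.+1).
  by apply/funext => t; rewrite !fctE mulrC.
apply: is_derive_eq; rewrite /GRing.scale /= mulr1.
have f0 : q`!%:R != 0 :> R by rewrite pnatr_eq0 -lt0n fact_gt0.
have q0 : q.+1%:R != 0 :> R by [].
by rewrite factS natrM invfM -mulrA mulrCA mulKf // mulrC.
Qed.

Lemma is_derive_truncpow_neq0 q x : x != 0 ->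
  is_derive x 1 (truncpow q.+1) (truncpow q x).
Proof.
move=> x0; have [xlt0|xge0] := ltP x 0.
- rewrite (truncpow_lt0 _ xlt0).
  apply: (near_eq_is_derive (f := cst 0)).
  near=> y; rewrite /cst /= truncpow_lt0 //.
  by near: y; exact: lt_nbhsl.
- have xgt0 : 0 < x by rewrite lt_neqAle eq_sym x0.
  rewrite {2}/truncpow xge0.
  apply: (near_eq_is_derive (f := fun t : R => t ^+ q.+1 / q.+1`!%:R)); last first.
    exact: is_derive_powfact.
  near=> y; rewrite /truncpow ifT //; apply: ltW.
  by near: y; exact: lt_nbhsr.
Unshelve. all: by end_near. Qed.

Lemma is_derive_truncpow q x : is_derive x 1 (truncpow q.+2) (truncpow q.+1 x).
Proof.
have [->|] := eqVneq x 0; last exact: is_derive_truncpow_neq0.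
rewrite truncpow_le0 //.
suff H : (fun h => h^-1 *: (truncpow q.+2 (h *: 1 + 0) - truncpow q.+2 0)) @ 0^' --> (0 : R).
  apply: DeriveDef; first by apply/cvg_ex; exists 0.
  exact: cvg_lim.
rewrite truncpow_le0 //.
(* The quotient at 0 is h_+^(q+1) / ((q+2) (q+1)!), at most |h| in absolute value for |h| <= 1. *)
apply: (@cvg_to_0_linear _ _ 1 1 ltr01) => h /andP[h0 /ltW h1].
rewrite /GRing.scale /= mulr1 addr0 subr0 mul1r.
rewrite normr_gt0 in h0.
have := mulid_truncpow q.+1 h; rewrite mulrC => /(canRL (mulfK h0)) E.
have q0 : q.+2%:R != 0 :> R by [].
have -> : h^-1 * truncpow q.+2 h = truncpow q.+1 h / q.+2%:R.
  by rewrite E mulrAC [q.+2%:R * _]mulrC mulfK // mulrC.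
rewrite /truncpow; case: ifP => _; last by rewrite mul0r normr0.
rewrite !normrM normrX !normfV !normr_nat -mulrA -invfM -natrM.
have d0 : (0 < q.+1`! * q.+2)%N by rewrite muln_gt0 fact_gt0.
rewrite ler_pdivrMr ?ltr0n // exprS.
by rewrite ler_wpM2l // (@le_trans _ _ 1) ?exprn_ile1 ?ler1n.
Qed.

(* Index 1 may have kinks, hence the exceptional finite set at the last step. *)
Definition derivative_tower h F :=
  (forall q x, is_derive x 1 (F q.+2) (h * F q.+1 x)) /\
  exists s : seq R, forall x, x \notin s -> is_derive x 1 (F 1) (h * F 0 x).

Lemma truncpow_tower : derivative_tower 1 truncpow.
Proof.
split=> [q x|]; first by rewrite mul1r; exact: is_derive_truncpow.
exists [:: 0] => x; rewrite inE mul1r; exact: is_derive_truncpow_neq0.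
Qed.

Lemma derivative_towerB h F G : derivative_tower h F -> derivative_tower h G ->
  derivative_tower h (fun q x => F q x - G q x).
Proof.
move=> [F2 [s Fs]] [G2 [t Gt]]; split=> [q x|].
  by rewrite mulrBr; exact: is_deriveB.
exists (s ++ t) => x; rewrite mem_cat negb_or => /andP[xs xt].
by rewrite mulrBr; apply: is_deriveB; [exact: Fs|exact: Gt].
Qed.

Lemma is_derive_affine a c x : is_derive x 1 (fun t : R => a * t + c) a.
Proof.
have -> : (fun t : R => a * t + c) = a *: id + cst c.
  by apply/funext.
apply: is_derive_eq; by rewrite addr0 /GRing.scale /= mulr1.
Qed.

(** Chain rule: each derivative gains a factor a, and the exceptional points are pulled back. The
    factor [h] of a tower records this scale. *)
Lemma derivative_tower_affine h a c F : a != 0 -> derivative_tower h F ->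
  derivative_tower (h * a) (fun q x => F q (a * x + c)).
Proof.
move=> a0 [F2 [s Fs]]; split=> [q x|].
  rewrite mulrAC.
  exact: (@is_derive1_comp _ (F q.+2) (fun t => a * t + c) x _ _
            (F2 q (a * x + c)) (is_derive_affine a c x)).
exists [seq (y - c) / a | y <- s] => x xs; rewrite mulrAC.
apply: (@is_derive1_comp _ (F 1) (fun t => a * t + c) x _ _
          (Fs (a * x + c) _) (is_derive_affine a c x)).
apply: contra xs => xs; apply/mapP; exists (a * x + c) => //.
by rewrite addrK mulrC mulKf.
Qed.

Lemma nabla_tower h m F : derivative_tower h F ->
  derivative_tower h (fun q => iter m nabla (F q)).
Proof.
move=> hF; elim: m => [//|m IH].
have H := derivative_tower_affine (-1) (oner_neq0 R) IH; rewrite mulr1 in H.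
have := derivative_towerB IH H; congr derivative_tower.
by apply/funext => q; apply/funext => x; rewrite /= /nabla mul1r.
Qed.

Lemma derive1n_tower h F s q : derivative_tower h F ->
  (s < q)%N -> derive1n s (F q) = fun x => h ^+ s * F (q - s)%N x.
Proof.
move=> [F2 _]; elim: s => [|s IH] sq.
  by rewrite subn0; apply/funext => x; rewrite expr0 mul1r.
rewrite derive1nS IH; last exact: ltnW.
apply/funext => x; rewrite derive1E.
have -> : (q - s = (q - s.+2).+2)%N by lia.
have -> : (q - s.+1 = (q - s.+2).+1)%N by lia.
have D := @is_deriveZ _ _ _ (F (q - s.+2).+2) (h ^+ s) x 1 _ (F2 (q - s.+2)%N x).
have := @derive_val _ _ _ _ _ _ _ D.
by rewrite exprSr -mulrA.
Qed.

(** The extra case s = q takes one last derivative, from index 1, which exists only off the kinks.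
    It occurs for r = p, where N_p^(p) is a step function. *)
Lemma derive1n_tower_off h F s q : derivative_tower h F -> (s <= q)%N ->
  exists l : seq R, forall x, x \notin l -> derive1n s (F q) x = h ^+ s * F (q - s)%N x.
Proof.
move=> hF; rewrite leq_eqVlt => /orP[/eqP->|sq]; last first.
  by exists [::] => x _; rewrite (derive1n_tower hF sq).
case: q => [|q]; first by exists [::] => x _; rewrite expr0 mul1r.
have [F2 [l Fl]] := hF; exists l => x xl.
rewrite derive1nS (derive1n_tower hF) // subSnn subnn derive1E.
have D := @is_deriveZ _ _ _ (F 1) (h ^+ q) x 1 _ (Fl x xl).
have := @derive_val _ _ _ _ _ _ _ D.
by rewrite exprSr -mulrA.
Qed.

(** Derivatives are local; this allows differentiating a formula that is valid only on ]0, 1[. *)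
Lemma eq_derive1n_open (U : set R) (f g : R -> R) s : open U ->
  (forall x, U x -> f x = g x) -> forall x, U x -> derive1n s f x = derive1n s g x.
Proof.
move=> oU fg; elim: s => [//|s IH] x Ux.
rewrite !derive1nS !derive1E; apply: near_eq_derive.
by near=> y; apply: IH; near: y; exact: open_nbhs_nbhs.
Unshelve. all: by end_near. Qed.

End DerivativeTowers.

(** * Integrals over the line: affine substitution and convolution *)

Section LineIntegrals.
Context {R : realType}.
Implicit Types (f g : R -> R) (a b c s x : R).
Local Notation mu := (@lebesgue_measure R).
Local Notation "'Int' f" := (\int[mu]_x f x) (at level 10, f at level 8).

(** Truncated powers are not integrable over the line; this class contains them and is closed under
    products, differences and affine substitutions. *)
Definition loc_bounded_meas f := measurable_fun [set: R] f /\
  forall M : R, exists C : R, forall x, `|x| <= M -> `|f x| <= C.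

Definition comp_supp_meas f := loc_bounded_meas f /\
  exists L : R, forall x, L < `|x| -> f x = 0.

Lemma loc_bounded_measM f g : loc_bounded_meas f -> loc_bounded_meas g ->
  loc_bounded_meas (fun x => f x * g x).
Proof.
move=> [mf bf] [mg bg]; split; first exact: measurable_funM.
move=> M; have [C fC] := bf M; have [D gD] := bg M.
exists (C * D) => x xM; rewrite normrM.
by apply: ler_pM => //; [exact: fC|exact: gD].
Qed.

Lemma loc_bounded_measB f g : loc_bounded_meas f -> loc_bounded_meas g ->
  loc_bounded_meas (fun x => f x - g x).
Proof.
move=> [mf bf] [mg bg]; split; first exact: measurable_funB.
move=> M; have [C fC] := bf M; have [D gD] := bg M.
exists (C + D) => x xM; rewrite (le_trans (ler_normB _ _)) //.
by apply: lerD; [exact: fC|exact: gD].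
Qed.

Lemma loc_bounded_measD f g : loc_bounded_meas f -> loc_bounded_meas g ->
  loc_bounded_meas (fun x => f x + g x).
Proof.
move=> [mf bf] [mg bg]; split; first exact: measurable_funD.
move=> M; have [C fC] := bf M; have [D gD] := bg M.
exists (C + D) => x xM; rewrite (le_trans (ler_normD _ _)) //.
by apply: lerD; [exact: fC|exact: gD].
Qed.

Lemma measurable_affine a b : measurable_fun [set: R] (fun x => a * x + b).
Proof. by apply: measurable_funD => //; apply: measurable_funM. Qed.

Lemma loc_bounded_meas_affine a b f : loc_bounded_meas f ->
  loc_bounded_meas (fun x => f (a * x + b)).
Proof.
move=> [mf bf]; split.
  exact: (measurableT_comp mf (measurable_affine a b)).
move=> M; have [C fC] := bf (`|a| * M + `|b|); exists C => x xM; apply: fC.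
by rewrite (le_trans (ler_normD _ _)) // normrM lerD2r ler_wpM2l.
Qed.

Lemma loc_bounded_meas_truncpow q : loc_bounded_meas (truncpow q).
Proof.
split.
  apply: measurable_fun_ifT => //=; first exact: measurable_fun_ler.
  by apply: measurable_funM => //; exact: measurable_funX.
move=> M; exists (`|M| ^+ q / q`!%:R) => x xM; rewrite /truncpow.
case: ifP => _; last by rewrite normr0 divr_ge0 // exprn_ge0.
rewrite normrM normrX normfV normr_nat ler_wpM2r ?invr_ge0 //.
by rewrite lerXn2r ?nnegrE // (le_trans xM) // ler_norm.
Qed.

Lemma loc_bounded_meas_nabla m f : loc_bounded_meas f ->
  loc_bounded_meas (iter m nabla f).
Proof.
move=> hf; elim: m => [//|m IH].
have := loc_bounded_measB IH (loc_bounded_meas_affine 1 (-1) IH).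
by congr loc_bounded_meas; apply/funext => x; rewrite /= /nabla mul1r.
Qed.

Lemma comp_supp_measM f g : loc_bounded_meas f -> comp_supp_meas g ->
  comp_supp_meas (fun x => f x * g x).
Proof.
move=> hf [hg [L gL]]; split; first exact: loc_bounded_measM.
by exists L => x xL; rewrite gL // mulr0.
Qed.

Lemma comp_supp_measB f g : comp_supp_meas f -> comp_supp_meas g ->
  comp_supp_meas (fun x => f x - g x).
Proof.
move=> [hf [L fL]] [hg [K gK]]; split; first exact: loc_bounded_measB.
exists (Num.max L K) => x; rewrite gt_max => /andP[xL xK].
by rewrite fL // gK // subrr.
Qed.

Lemma comp_supp_meas_itv a b f : loc_bounded_meas f ->
  (forall x, x < a -> f x = 0) -> (forall x, b < x -> f x = 0) -> comp_supp_meas f.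
Proof.
move=> hf fa fb; split => //; exists (`|a| + `|b|) => x.
case: (ltP x a) => [/fa //|ax]; case: (ltP b x) => [/fb //|xb].
have := ler_norm (- a); have := ler_norm b; have := normr_ge0 b.
have := normr_ge0 a; rewrite normrN => ? ? ? ?.
have xab : `|x| <= `|a| + `|b| by rewrite ler_norml; apply/andP; split; lra.
by rewrite ltNge xab.
Qed.

Lemma comp_supp_meas_affine a b f : a != 0 -> comp_supp_meas f ->
  comp_supp_meas (fun x => f (a * x + b)).
Proof.
move=> a0 [hf [L fL]]; split; first exact: loc_bounded_meas_affine.
exists ((L + `|b|) / `|a|) => x; rewrite ltr_pdivrMr ?normr_gt0 // => xL.
apply: fL; rewrite mulrC -normrM -(normrN b) in xL *.
rewrite -ltrBrDr in xL; apply: lt_le_trans xL _.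
by rewrite lerBlDr (le_trans _ (ler_normD _ _)) // addrK.
Qed.

Lemma comp_supp_integrable f : comp_supp_meas f -> mu.-integrable [set: R] (EFin \o f).
Proof.
move=> [[mf bf] [L fL]].
have [C fC] := bf L.
have mI : measurable (`[- L, L] : set (measurableTypeR R)) by [].
have I : mu.-integrable `[- L, L] (EFin \o f).
  apply: measurable_bounded_integrable => //.
  - by have /= -> := lebesgue_measure_itv `[- L, L]; case: ifP => _; rewrite -?EFinB ?ltry.
  - exact: measurable_funTS.
  - exists C; split; first exact: num_real.
    move=> D CD x /=; rewrite in_itv /= -ler_norml => /fC /le_trans; apply.
    exact: ltW.
apply: eq_integrable (proj1 (integrable_mkcond _ mI) I) => //.
move=> x _; rewrite patchE; case: ifPn => //.
by rewrite notin_setE /= in_itv /= -ler_norml => /negP; rewrite -ltNge => /fL /= ->.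
Qed.

Lemma IntB f g : comp_supp_meas f -> comp_supp_meas g ->
  Int (fun x => f x - g x) = Int f - Int g.
Proof. by move=> hf hg; rewrite RintegralB //; exact: comp_supp_integrable. Qed.

Lemma IntD f g : comp_supp_meas f -> comp_supp_meas g ->
  Int (fun x => f x + g x) = Int f + Int g.
Proof. by move=> hf hg; rewrite RintegralD //; exact: comp_supp_integrable. Qed.

Lemma IntZ c f : comp_supp_meas f -> Int (fun x => c * f x) = c * Int f.
Proof. by move=> hf; rewrite RintegralZl //; exact: comp_supp_integrable. Qed.

(** Finite sets are null. The induction alters f at one point at a time and carries its
    measurability along, which the comparison of integrals almost everywhere requires. *)
Lemma Int_eq_off f g (s : seq R) : measurable_fun [set: R] g ->
  (forall x, x \notin s -> f x = g x) -> Int f = Int g.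
Proof.
move=> mg fg; suff [] : measurable_fun [set: R] f /\ Int f = Int g by [].
elim: s f fg => [|a s IH] f fg.
  by have -> : f = g by apply/funext => x; exact: fg.
pose f' x := if x == a then g a else f x.
have [|mf' <-] := IH f'.
  move=> x xs; rewrite /f'; case: eqP => [-> //|/eqP xa].
  by apply: fg; rewrite inE negb_or xa.
have mf : measurable_fun [set: R] f.
  have -> : f = fun x => if x == a then f a else f' x.
    by apply/funext => x; rewrite /f'; case: eqP => [->|].
  by apply: measurable_fun_ifT => //; exact: measurable_fun_eqr.
split=> //; congr fine; apply: ae_eq_integral => //; try exact/measurable_EFinP.
exists [set a]; split => //; first exact: lebesgue_measure_set1.
move=> x /= /not_implyP[_]; apply: contra_notP => /eqP/negbTE xa.
by rewrite /f' xa.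
Qed.

(** By uniqueness of Lebesgue measure it suffices to compare both sides on intervals ]u, v]; for a <
    0 the preimage is closed on the left instead. *)
Lemma lebesgue_measure_affine a b (A : set R) : a != 0 -> measurable A ->
  mu A = (`|a|%:E * mu [set x : R | A (a * x + b)%R])%E.
Proof.
move=> a0 mA.
pose phi : measurableTypeR R -> measurableTypeR R := fun x => a * x + b.
have mphi : measurable_fun [set: measurableTypeR R] phi by exact: measurable_affine.
pose k : {nonneg R} := NngNum (normr_ge0 a).
apply: (@lebesgue_measure_unique R (mscale k (pushforward mu phi))) => //.
move=> _ [[u v]] _ <-.
change (mu `]u, v] = (`|a|%:E * mu [set x : R | (a * x + b)%R \in `]u, v]])%E).
have [a_lt0|a_gt0|/eqP] := ltgtP a 0; last by rewrite (negbTE a0).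
- have -> : [set x : R | a * x + b \in `]u, v]] = [set` `[(v - b) / a, (u - b) / a[].
    apply/seteqP; split=> x; rewrite /= !in_itv /= ler_ndivrMr // ltr_ndivlMr // => /andP[? ?];
      by apply/andP; split; lra.
  rewrite !lebesgue_measure_itv /= !lte_fin ltr_ndivrMr // divfK // ltrD2r.
  case: ifP => _; last by rewrite mule0.
  by rewrite -!EFinB -EFinM ltr0_norm // -mulrBl mulNr mulrC divfK //; congr EFin; ring.
- have -> : [set x : R | a * x + b \in `]u, v]] = [set` `](u - b) / a, (v - b) / a]].
    apply/seteqP; split=> x; rewrite /= !in_itv /= ltr_pdivrMr // ler_pdivlMr // => /andP[? ?];
      by apply/andP; split; lra.
  rewrite !lebesgue_measure_itv /= !lte_fin ltr_pdivrMr // divfK // ltrD2r.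
  case: ifP => _; last by rewrite mule0.
  by rewrite -!EFinB -EFinM gtr0_norm // -mulrBl mulrC divfK //; congr EFin; ring.
Qed.

Lemma ge0_Int_affine a b f : a != 0 -> comp_supp_meas f -> (forall x, 0 <= f x) ->
  Int f = `|a| * Int (fun x => f (a * x + b)).
Proof.
move=> a0 cf f0; have [[mf _] _] := cf.
pose phi : measurableTypeR R -> measurableTypeR R := fun x => a * x + b.
have mphi : measurable_fun [set: measurableTypeR R] phi by exact: measurable_affine.
pose k : {nonneg R} := NngNum (normr_ge0 a).
have mEf : measurable_fun [set: measurableTypeR R] (EFin \o f) by exact/measurable_EFinP.
rewrite /Rintegral.
rewrite (@eq_measure_integral _ _ _ _ (mscale k (pushforward mu phi)) mu); last first.
  by move=> A mA _; exact: lebesgue_measure_affine.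
rewrite ge0_integral_mscale //; last by move=> x _; rewrite lee_fin.
rewrite ge0_integral_pushforward //; last by move=> x _; rewrite lee_fin.
rewrite fineM //.
have := comp_supp_integrable (comp_supp_meas_affine b a0 cf).
exact: integrable_fin_num.
Qed.

Lemma comp_supp_meas_norm f : comp_supp_meas f -> comp_supp_meas (fun x => `|f x|).
Proof.
move=> [[mf bf] [L fL]]; split; first split.
- exact: measurableT_comp.
- by move=> M; have [C fC] := bf M; exists C => x; rewrite normr_id; exact: fC.
- by exists L => x /fL ->; rewrite normr0.
Qed.

(** Both |f| and |f| - f are nonnegative, so the substitution rule for nonnegative functions applies
    to each, and the results are subtracted. *)
Lemma Int_affine a b f : a != 0 -> comp_supp_meas f ->
  Int (fun x => f (a * x + b)) = `|a|^-1 * Int f.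
Proof.
move=> a0 cf; have cn := comp_supp_meas_norm cf.
have cB := comp_supp_measB cn cf.
have fE g : comp_supp_meas g -> (forall x, 0 <= g x) ->
    Int (fun x => g (a * x + b)) = `|a|^-1 * Int g.
  by move=> cg g0; rewrite (ge0_Int_affine b a0 cg g0) mulKf // normr_eq0.
have E1 := fE _ cn (fun x => normr_ge0 (f x)).
have E2 : Int (fun x => `|f (a * x + b)| - f (a * x + b)) = `|a|^-1 * Int (fun x => `|f x| - f x).
  by apply: (fE _ cB) => x; rewrite subr_ge0 ler_norm.
rewrite IntB // in E2; last 2 first.
- exact: (comp_supp_meas_affine b a0 cn).
- exact: (comp_supp_meas_affine b a0 cf).
rewrite IntB // E1 mulrBr in E2.
by lra.
Qed.

Definition convolution f g s := Int (fun y => f y * g (s - y)).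

(** The translation y -> y - 1 moves the shift from f to s. Compact support is assumed of the
    products because truncated powers lack it; the first conclusion lets the lemma be iterated. *)
Lemma conv_nablal f g :
  (forall s, comp_supp_meas (fun y => f y * g (s - y))) ->
  (forall s, comp_supp_meas (fun y => nabla f y * g (s - y))) /\
  (forall s, convolution (nabla f) g s = nabla (convolution f g) s).
Proof.
move=> cfg.
have E s y : nabla f y * g (s - y) =
    f y * g (s - y) - f (1 * y - 1) * g (s - 1 - (1 * y - 1)).
  by rewrite /nabla mul1r mulrBl; congr (_ - _ * g _); ring.
have c1 s := comp_supp_meas_affine (-1) (oner_neq0 R) (cfg (s - 1)).
split=> s.
  have := comp_supp_measB (cfg s) (c1 s).
  by congr comp_supp_meas; apply/funext => y; rewrite E.
rewrite /convolution; under eq_Rintegral do rewrite E.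
rewrite (IntB (cfg s) (c1 s)) (Int_affine (-1) (oner_neq0 R) (cfg (s - 1))).
by rewrite normr1 invr1 mul1r.
Qed.

Lemma conv_nablar f g :
  (forall s, comp_supp_meas (fun y => f y * g (s - y))) ->
  (forall s, comp_supp_meas (fun y => f y * nabla g (s - y))) /\
  (forall s, convolution f (nabla g) s = nabla (convolution f g) s).
Proof.
move=> cfg.
have E s y : f y * nabla g (s - y) = f y * g (s - y) - f y * g (s - 1 - y).
  by rewrite /nabla mulrBr addrAC.
split=> s.
  have := comp_supp_measB (cfg s) (cfg (s - 1)).
  by congr comp_supp_meas; apply/funext => y; rewrite E.
rewrite /convolution; under eq_Rintegral do rewrite E.
by rewrite (IntB (cfg s) (cfg (s - 1))).
Qed.

Lemma conv_iter_nabla m k f g :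
  (forall s, comp_supp_meas (fun y => f y * g (s - y))) ->
  forall s, convolution (iter m nabla f) (iter k nabla g) s =
    iter (m + k) nabla (convolution f g) s.
Proof.
move=> cfg.
have [ck Ek] : (forall s, comp_supp_meas (fun y => f y * iter k nabla g (s - y))) /\
    convolution f (iter k nabla g) = iter k nabla (convolution f g).
  elim: k => [//|k [ck Ek]]; have [? E] := conv_nablar ck; split=> //.
  by rewrite [RHS]iterS -Ek; apply/funext => s; exact: E.
suff [_ ->] : (forall s, comp_supp_meas (fun y => iter m nabla f y * iter k nabla g (s - y))) /\
    convolution (iter m nabla f) (iter k nabla g) = iter (m + k) nabla (convolution f g) by [].
elim: m => [//|m [cm Em]]; have [? E] := conv_nablal cm; split=> //.
by rewrite addSn [RHS]iterS -Em; apply/funext => s; exact: E.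
Qed.

Lemma comp_supp_truncpow p q s :
  comp_supp_meas (fun y : R => truncpow p y * truncpow q (s - y)).
Proof.
apply: (@comp_supp_meas_itv 0 s).
- apply: loc_bounded_measM; first exact: loc_bounded_meas_truncpow.
  have := loc_bounded_meas_affine (-1) s (loc_bounded_meas_truncpow q).
  by congr loc_bounded_meas; apply/funext => y; rewrite mulN1r addrC.
- by move=> x x0; rewrite truncpow_lt0 // mul0r.
- by move=> x xs; rewrite [X in _ * X]truncpow_lt0 ?mulr0 // subr_lt0.
Qed.

(** A primitive of y^p / p! * (s - y)^q / q!, obtained by q integrations by parts. *)
Fixpoint beta_primitive s p q : R -> R :=
  if q is q'.+1 then
    fun y => y ^+ p.+1 / p.+1`!%:R * ((s - y) ^+ q / q`!%:R) + beta_primitive s p.+1 q' y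
  else fun y => y ^+ p.+1 / p.+1`!%:R.

Lemma is_derive_beta_primitive s (p q : nat) (y : R) :
  is_derive y 1 (beta_primitive s p q) (y ^+ p / p`!%:R * ((s - y) ^+ q / q`!%:R)).
Proof.
elim: q p => [|q IH] p /=.
  by rewrite expr0 fact0 divr1 mulr1; exact: is_derive_powfact.
have D1 := is_derive_powfact p y.
have D2 : is_derive y 1 (fun t => (s - t) ^+ q.+1 / q.+1`!%:R) ((s - y) ^+ q / q`!%:R * -1).
  have Da := is_derive_affine (-1) s y.
  have := @is_derive1_comp _ (fun t => t ^+ q.+1 / q.+1`!%:R) (fun t => -1 * t + s) y _ _
            (is_derive_powfact q _) Da.
  rewrite mulN1r (addrC _ s); congr is_derive.
  by apply/funext => t /=; rewrite mulN1r (addrC _ s).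
have D := is_deriveD (is_deriveM D1 D2) (IH p.+1).
apply: (is_derive_eq D); rewrite /GRing.scale /=; ring.
Qed.

(** This is the Beta integral; the factorials in [truncpow] absorb its value p! q! / (p + q +
    1)!. *)
Lemma conv_truncpow p q s : convolution (truncpow p) (truncpow q) s = truncpow (p + q).+1 s.
Proof.
have [s0|s0] := ltP 0 s; last first.
  (* For s <= 0 the integrand vanishes off y = 0, but not at y = 0 when s = 0 and p = q = 0. *)
  rewrite truncpow_le0 // /convolution (@Int_eq_off _ (fun=> 0 * 0) [:: 0]) //.
    by under eq_Rintegral do rewrite mulr0; rewrite Rintegral_cst // mul0r.
  move=> x; rewrite inE => x0; rewrite mulr0.
  have [xlt|xge] := ltP x 0; first by rewrite truncpow_lt0 // mul0r.
  by rewrite [X in _ * X]truncpow_lt0 ?mulr0 // subr_lt0 (le_lt_trans s0) // lt_neqAle eq_sym x0.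
rewrite /convolution.
transitivity (\int[mu]_(y in `[0, s]) (y ^+ p / p`!%:R * ((s - y) ^+ q / q`!%:R))).
  rewrite [RHS]Rintegral_mkcond; apply: eq_Rintegral => y _.
  rewrite patchE; case: ifPn; rewrite ?inE ?notin_setE /= in_itv /=.
    by move=> /andP[y0 ys]; rewrite /truncpow y0 subr_ge0 ys.
  move=> /negP; rewrite negb_and -!ltNge => /orP[y0|sy].
    by rewrite truncpow_lt0 // mul0r.
  by rewrite [X in _ * X]truncpow_lt0 ?mulr0 // subr_lt0.
have dB y : derivable (beta_primitive s p q) y 1.
  by have [] := is_derive_beta_primitive s p q y.
have cB : continuous (beta_primitive s p q).
  by move=> y; apply/differentiable_continuous/derivable1_diffP.
rewrite /Rintegral (@continuous_FTC2 _ _ (beta_primitive s p q)) //.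
- have -> : beta_primitive s p q 0 = 0.
    elim: q p {dB cB} => [|q IH] p /=; rewrite ?IH expr0n /= !mul0r ?addr0 //.
  rewrite -EFinB /= subr0.
  (* At y = s only the last summand, s^(p+q+1) / (p+q+1)!, has no factor s - y. *)
  elim: q p {dB cB} => [|q IH] p /=; first by rewrite addn0 /truncpow ltW.
  by rewrite IH subrr expr0n /= mul0r mulr0 add0r addSnnS.
- have cX (k : nat) : continuous (fun t : R => t ^+ k / k`!%:R).
    by move=> t; apply: cvgM; [exact: exprn_continuous|exact: cvg_cst].
  apply: continuous_subspaceT => y; apply: cvgM; first exact: cX.
  apply: (@continuous_comp _ _ _ (fun x => s - x) (fun t => t ^+ q / q`!%:R)).
    by apply: cvgB; [exact: cvg_cst|exact: cvg_id].
  exact: cX.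
- split; first by move=> y _; exact: dB.
    by apply: cvg_at_right_filter; exact: cB.
  by apply: cvg_at_left_filter; exact: cB.
- move=> y _; rewrite derive1E.
  exact: (@derive_val _ _ _ _ _ _ _ (is_derive_beta_primitive s p q y)).
Qed.

End LineIntegrals.

(** * Inner products of differentiated B-splines *)

Section GramMatrix.
Context {R : realType}.
Variables (p r : nat).
Hypothesis rp : (r <= p)%N.
Implicit Types (J : R -> R) (a b c d x y S : R).
Local Notation mu := (@lebesgue_measure R).
Local Notation "'Int' f" := (\int[mu]_x f x) (at level 10, f at level 8).

(** The function w of the introductory outline; for r = p it takes the value from the right at the
    knots. *)
Definition dspline : R -> R := iter p.+1 nabla (truncpow (p - r)).

Lemma dspline_lt0 y : y < 0 -> dspline y = 0.
Proof. exact: iter_nabla_truncpow_lt0. Qed.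

Lemma dspline_ge y : p.+1%:R <= y -> dspline y = 0.
Proof. by apply: iter_nabla_truncpow_ge; rewrite ltnS leq_subr. Qed.

Lemma loc_bounded_meas_dspline : loc_bounded_meas dspline.
Proof. exact/loc_bounded_meas_nabla/loc_bounded_meas_truncpow. Qed.

Lemma comp_supp_dspline : comp_supp_meas dspline.
Proof.
apply: (@comp_supp_meas_itv _ 0 p.+1%:R) => [|x|x /ltW].
- exact: loc_bounded_meas_dspline.
- exact: dspline_lt0.
- exact: dspline_ge.
Qed.

Lemma dspline_sym y : (forall k, (k <= p.+1)%N -> y != k%:R) ->
  dspline y = (-1) ^+ r * dspline (p.+1%:R - y).
Proof.
move=> yk; rewrite /dspline iter_nabla_truncpow_sym ?ltnS ?leq_subr //.
rewrite mulrA -exprD -signr_odd.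
have -> : odd (r + (p.+1 + (p - r)).+1) = false by lia.
by rewrite expr0 mul1r.
Qed.

Definition gram a b := Int (fun y => dspline (y - a) * dspline (y - b)).

Lemma gramC a b : gram a b = gram b a.
Proof. by apply: eq_Rintegral => y _; rewrite mulrC. Qed.

(** Symmetry rewrites w(y - b) as (-1)^r w(p + 1 + b - y), so the integral becomes the convolution
    of w with itself at p + 1 + b - a, and there the differences pull out. *)
Lemma gram_truncpow a b : gram a b =
  (-1) ^+ r * iter (p.+1 + p.+1) nabla (truncpow (p - r + (p - r)).+1) (p.+1%:R + b - a).
Proof.
have cW s : comp_supp_meas (fun y => dspline y * dspline (s - y)).
  have lW := loc_bounded_meas_affine (-1) s loc_bounded_meas_dspline.
  have := comp_supp_measM lW comp_supp_dspline.
  by congr comp_supp_meas; apply/funext => y; rewrite mulrC mulN1r addrC.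
have <- : convolution (truncpow (p - r)) (truncpow (p - r)) =
    truncpow (p - r + (p - r)).+1 :> (R -> R).
  by apply/funext => s; rewrite conv_truncpow.
rewrite -conv_iter_nabla; last by move=> s; exact: comp_supp_truncpow.
rewrite -/dspline /convolution -IntZ; last exact: cW.
pose g y := (-1) ^+ r * (dspline y * dspline (p.+1%:R + b - a - y)).
have cg : comp_supp_meas g.
  apply: comp_supp_measM; last exact: cW.
  by split; [exact: measurable_cst|move=> M; exists 1 => x _; rewrite normrX normrN1 expr1n].
have := Int_affine (- a) (oner_neq0 R) cg.
rewrite normr1 invr1 mul1r => <-.
(* These are the knots of the second factor, where the symmetry of w may fail. *)
apply: (@Int_eq_off _ _ _ [seq b + k%:R | k <- iota 0 p.+2]).
  by have [[]] := comp_supp_meas_affine (- a) (oner_neq0 R) cg.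
move=> y ys; rewrite /g mul1r mulrCA; congr (_ * _).
rewrite dspline_sym; first by congr (_ * dspline _); ring.
move=> k kp; apply: contra ys => /eqP yk; apply/mapP; exists k.
  by rewrite mem_iota.
by rewrite -yk addrC subrK.
Qed.

(** Since 2r < 2p + 1, the 2r derivatives exist everywhere. For k > p the convention alpha_k = 0
    agrees with the formula because p + 1 - k <= 0. *)
Lemma alphaE k : @alpha R p r k =
  (-1) ^+ r * iter (p.+1 + p.+1) nabla (truncpow (p - r + (p - r)).+1) (p.+1%:R - k%:R).
Proof.
rewrite /alpha; case: leqP => kp; last first.
  rewrite iter_nabla_truncpow_le0 ?mulr0 // subr_le0 ler_nat //.
have -> : @bspline R (2 * p + 1) = iter (p.+1 + p.+1) nabla (truncpow (2 * p + 1)).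
  have -> : (p.+1 + p.+1 = (2 * p + 1).+1)%N by lia.
  by apply/funext => t; rewrite bspline_truncpow.
rewrite (derive1n_tower (nabla_tower (p.+1 + p.+1) truncpow_tower)); last by lia.
by rewrite expr1n mul1r; have -> : (2 * p + 1 - 2 * r = (p - r + (p - r)).+1)%N by lia.
Qed.

Lemma gram_alpha a b k : a - b = k%:R -> gram a b = @alpha R p r k.
Proof.
by move=> abk; rewrite gram_truncpow alphaE -abk opprB addrA.
Qed.

Definition cspline c y := dspline (y - c + p.+1%:R / 2).

(** The weight [J] will be the indicator of the rescaled unit interval, or a sum of its reflections,
    so that every integral runs over the whole line. *)
Definition wgram J c d := Int (fun y => J y * (cspline c y * cspline d y)).

Lemma loc_bounded_meas_cspline c : loc_bounded_meas (cspline c).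
Proof.
have := loc_bounded_meas_affine 1 (- c + p.+1%:R / 2) loc_bounded_meas_dspline.
by congr loc_bounded_meas; apply/funext => y; rewrite mul1r addrA.
Qed.

Lemma comp_supp_cspline c : comp_supp_meas (cspline c).
Proof.
have := comp_supp_meas_affine (- c + p.+1%:R / 2) (oner_neq0 R) comp_supp_dspline.
by congr comp_supp_meas; apply/funext => y; rewrite mul1r addrA.
Qed.

Lemma comp_supp_wgram J c d : loc_bounded_meas J ->
  comp_supp_meas (fun y => J y * (cspline c y * cspline d y)).
Proof.
move=> hJ; apply: comp_supp_measM => //; apply: comp_supp_measM.
  exact: loc_bounded_meas_cspline.
exact: comp_supp_cspline.
Qed.

Lemma cspline_lt c y : y < c - p.+1%:R / 2 -> cspline c y = 0.
Proof. by move=> yc; apply: dspline_lt0; lra. Qed.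

Lemma cspline_ge c y : c + p.+1%:R / 2 <= y -> cspline c y = 0.
Proof. by move=> yc; apply: dspline_ge; lra. Qed.

Lemma cspline_reflect S c y :
  (forall k, (k <= p.+1)%N -> y != k%:R + S - c - p.+1%:R / 2) ->
  cspline (S - c) y = (-1) ^+ r * cspline c (S - y).
Proof.
move=> yk; rewrite /cspline dspline_sym; last first.
  move=> k /yk; apply: contra => /eqP <-; apply/eqP; ring.
congr (_ * dspline _); lra.
Qed.

(** The reflection y -> S - y exchanges the centres c and S - c, and the two signs (-1)^r cancel in
    the product, so only the weight changes. *)
Lemma wgram_reflect J S c d : loc_bounded_meas J ->
  wgram J (S - c) (S - d) = wgram (fun y => J (S - y)) c d.
Proof.
move=> hJ; have N1 : -1 != 0 :> R by rewrite oppr_eq0 oner_eq0.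
have hJS : loc_bounded_meas (fun y => J (S - y)).
  have := loc_bounded_meas_affine (-1) S hJ.
  by congr loc_bounded_meas; apply/funext => y; rewrite mulN1r addrC.
have cJ := comp_supp_wgram c d hJS.
rewrite /wgram; have := Int_affine S N1 cJ; rewrite normrN1 invr1 mul1r => <-.
pose knots e := [seq k%:R + S - e - p.+1%:R / 2 | k <- iota 0 p.+2] : seq R.
have kn e y : y \notin knots e ->
    forall k, (k <= p.+1)%N -> y != k%:R + S - e - p.+1%:R / 2.
  move=> yk k kp; apply: contra yk => /eqP ->; apply/mapP; exists k => //.
  by rewrite mem_iota.
apply: (@Int_eq_off _ _ _ (knots c ++ knots d)).
  by have [[]] := comp_supp_meas_affine S N1 cJ.
move=> y; rewrite mem_cat negb_or => /andP[/kn yc /kn yd].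
rewrite !cspline_reflect // mulN1r (addrC (- y)) subKr.
by rewrite mulrACA -expr2 sqrr_sign mul1r.
Qed.

Lemma wgramD J1 J2 c d : loc_bounded_meas J1 -> loc_bounded_meas J2 ->
  wgram J1 c d + wgram J2 c d = wgram (fun y => J1 y + J2 y) c d.
Proof.
move=> h1 h2; rewrite /wgram -IntD; try exact: comp_supp_wgram.
by apply: eq_Rintegral => y _ /=; rewrite [RHS]mulrDl.
Qed.

(** The weight may differ from 1 where the product vanishes and at finitely many points, such as
    those shared by two reflected cells. Subtracting (p + 1)/2 turns a centre into the left end of
    its support. *)
Lemma wgram1 J c d (s : seq R) :
  (forall y, y \notin s -> J y * (cspline c y * cspline d y) = cspline c y * cspline d y) ->
  wgram J c d = gram (c - p.+1%:R / 2) (d - p.+1%:R / 2).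
Proof.
move=> Js.
have E e y : dspline (y - (e - p.+1%:R / 2)) = cspline e y.
  by congr dspline; ring.
rewrite /gram; under [RHS]eq_Rintegral do rewrite !E.
apply: (@Int_eq_off _ _ _ s) => //.
have [mc _] := loc_bounded_meas_cspline c; have [md _] := loc_bounded_meas_cspline d.
exact: measurable_funM.
Qed.

Lemma wgram0 J c d :
  c + p.+1%:R / 2 < d - p.+1%:R / 2 -> wgram J c d = 0.
Proof.
move=> cd; rewrite /wgram (@Int_eq_off _ _ (fun=> 0) [::]) //.
  by rewrite Rintegral_cst // mul0r.
move=> y _; have [yd|yd] := ltP y (d - p.+1%:R / 2).
  by rewrite (cspline_lt yd) !mulr0.
by rewrite (@cspline_ge c) ?mul0r ?mulr0 // ltW // (lt_le_trans cd).
Qed.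

Lemma wgram_sym J c d : wgram J c d = wgram J d c.
Proof. by apply: eq_Rintegral => y _; rewrite (mulrC (cspline c y)). Qed.

End GramMatrix.

(** * The mixed basis and the folding of the unit interval *)

Lemma sumZ_supp01 (R : realType) (f : int -> R) :
  (forall m, m != 0 -> m != 1 -> f m = 0) -> sumZ f = f 0 + f 1.
Proof.
move=> f0; rewrite /sumZ; apply: cvg_lim => //; apply: cvg_near_cst.
near=> N; have N1 : (1 <= N)%N by near: N; exact: nbhs_infty_ge.
(* Index k stands for m = k - N, so m = 0 and m = 1 sit at k = N and k = N + 1. *)
rewrite (@big_cat_nat _ _ _ N) //=; last by lia.
rewrite (@big_cat_nat _ _ _ N.+2 N) //=; try lia.
rewrite big_nat big1 => [|k kN]; last by apply: f0; lia.
rewrite big_nat_recr //= big_nat1.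
rewrite [X in _ + (_ + X)]big_nat [X in _ + (_ + X)]big1 => [|k kN]; last by apply: f0; lia.
by rewrite add0r addr0; congr (f _ + f _); lia.
Unshelve. all: by end_near. Qed.

Section MixedBasis.
Context {R : realType}.
Variables (p n r : nat).
Hypotheses (rp : (r <= p)%N) (pn : (p < n)%N).
Implicit Types (c x y : R).
Local Notation mu := (@lebesgue_measure R).
Local Notation "'Int' f" := (\int[mu]_x f x) (at level 10, f at level 8).
Local Notation M := ((2 * n + 1)%:R : R).
Local Notation h := (M / 2).

Lemma Dc_lt0 c x : h * x < c - p.+1%:R / 2 -> Dc p n c x = 0.
Proof. by move=> H; apply: bspline_lt0; lra. Qed.

Lemma Dc_ge c x : c + p.+1%:R / 2 <= h * x -> Dc p n c x = 0.
Proof. by move=> H; apply: bspline_ge; lra. Qed.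

Let nR : p.+1%:R <= n%:R :> R. Proof. by rewrite ler_nat. Qed.
Let ME : M = 2 * n%:R + 1. Proof. by rewrite natrD natrM. Qed.
Let p0 : 0 < p.+1%:R :> R. Proof. by []. Qed.
Let h0 : 0 < h. Proof. by have := nR; have := ME; have := p0; lra. Qed.

(* Only the translates m = 0 and m = 1 reach the unit interval. *)
Lemma Nmix_unit_interval i x : (0 < i <= n)%N -> 0 < x < 1 ->
  Nmix p n i x = Dc p n i%:R x - (Dc p n (- i%:R) x - Dc p n (M - i%:R) x).
Proof.
move=> /andP[i0 iN] /andP[x0 x1].
have i1 : 1 <= i%:R :> R by rewrite ler1n.
have in' : i%:R <= n%:R :> R by rewrite ler_nat.
have hx0 : 0 < h * x by rewrite mulr_gt0.
have hx1 : h * x < h by rewrite gtr_pMr.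
have := nR; have := ME; have := p0 => P0 HM HN.
rewrite /Nmix sumZ_supp01.
  rewrite expr0z expr1z !mul0r !mul1r !addr0 !intrD !intrN -!pmulrn.
  (* For m = 1 two minus signs make the centre M - i enter positively; the centre M + i is out of
     reach. *)
  rewrite [Dc p n (i%:R + M) x]Dc_lt0; last by lra.
  by rewrite (addrC (- i%:R)); ring.
move=> m m0 m1.
have [m2|m2] : (2 <= m) \/ (m <= -1) by lia.
  have HmM : 2 * M <= m%:~R * M.
    by rewrite ler_wpM2r // (_ : 2 = (2%:Z)%:~R) // ler_int.
  by rewrite !Dc_lt0 ?subrr ?mulr0 // intrD intrM ?intrN -!pmulrn; lra.
have HmM : m%:~R * M <= -1 * M.
  by rewrite ler_wpM2r // (_ : -1 = (-1)%:~R) // ler_int.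
by rewrite !Dc_ge ?subrr ?mulr0 // intrD intrM ?intrN -!pmulrn; lra.
Qed.

Definition mixed_dspline i y : R :=
  cspline p r i%:R y - (cspline p r (- i%:R) y - cspline p r (M - i%:R) y).

(** On ]0, 1[ the function combines three affine images of one tower, all of scale h, so each
    derivative contributes a factor h. *)
Lemma derive1n_Nmix i : (0 < i <= n)%N -> exists l : seq R,
  forall x, 0 < x < 1 -> x \notin l ->
  derive1n r (Nmix p n i) x = h ^+ r * mixed_dspline i (h * x).
Proof.
move=> iN; have hn0 : h != 0 by rewrite gt_eqF.
pose F q x := iter p.+1 nabla (truncpow q) x : R.
have tF : derivative_tower 1 F := nabla_tower p.+1 truncpow_tower.
have tF' c := derivative_tower_affine (- c + p.+1%:R / 2) hn0 tF.
have := derivative_towerB (tF' i%:R) (derivative_towerB (tF' (- i%:R)) (tF' (M - i%:R))).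
rewrite mul1r => /derive1n_tower_off/(_ rp)[l H]; exists l => x x01 xl.
rewrite (@eq_derive1n_open _ `]0, 1[ _ (fun x => F p (h * x + (- i%:R + p.+1%:R / 2))
  - (F p (h * x + (- - i%:R + p.+1%:R / 2)) - F p (h * x + (- (M - i%:R) + p.+1%:R / 2))))).
- by rewrite H // /mixed_dspline /cspline !addrA.
- exact: itv_open.
- move=> y; rewrite /= in_itv /= => y01; rewrite Nmix_unit_interval // /Dc.
  by rewrite !bspline_truncpow !addrA.
- by rewrite /= in_itv.
Qed.

Definition unit_cell y : R := if (0 <= y) && (y <= h) then 1 else 0.

Lemma unit_cell_in y : 0 <= y -> y <= h -> unit_cell y = 1.
Proof. by rewrite /unit_cell => -> ->. Qed.

Lemma unit_cell_lt y : y < 0 -> unit_cell y = 0.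
Proof. by rewrite /unit_cell ltNge => /negbTE ->. Qed.

Lemma unit_cell_gt y : h < y -> unit_cell y = 0.
Proof. by rewrite /unit_cell ltNge => /negbTE ->; rewrite andbF. Qed.

Lemma loc_bounded_meas_unit_cell : loc_bounded_meas unit_cell.
Proof.
split.
  apply: measurable_fun_ifT => //.
  by apply: measurable_and; exact: measurable_fun_ler.
by move=> L; exists 1 => y _; rewrite /unit_cell; case: ifP; rewrite ?normr1 ?normr0.
Qed.

Local Notation W := (wgram p r).

Lemma Int_mixed J (f1 f2 f3 g : R -> R) :
  comp_supp_meas (fun y => J y * (f1 y * g y)) ->
  comp_supp_meas (fun y => J y * (f2 y * g y)) ->
  comp_supp_meas (fun y => J y * (f3 y * g y)) ->
  Int (fun y => J y * ((f1 y - (f2 y - f3 y)) * g y)) =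
  Int (fun y => J y * (f1 y * g y)) - (Int (fun y => J y * (f2 y * g y)) -
  Int (fun y => J y * (f3 y * g y))).
Proof.
move=> c1 c2 c3; rewrite -IntB // -IntB //; last exact: comp_supp_measB.
by apply: eq_Rintegral => y _ /=; ring.
Qed.

(** The substitution y = h x contributes 1 / h and the derivatives contribute h^(2r); bilinearity
    over the three centres of each factor gives nine terms. *)
Lemma Xmat_wgram i j : (0 < i <= n)%N -> (0 < j <= n)%N ->
  let K := W unit_cell in
  @Xmat R p r n i j = h ^+ (2 * r) / h *
   (K i%:R j%:R - (K i%:R (- j%:R) - K i%:R (M - j%:R))
    - (K (- i%:R) j%:R - (K (- i%:R) (- j%:R) - K (- i%:R) (M - j%:R))
    - (K (M - i%:R) j%:R - (K (M - i%:R) (- j%:R) - K (M - i%:R) (M - j%:R))))).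
Proof.
move=> iN jN K.
have [li Hi] := derive1n_Nmix iN; have [lj Hj] := derive1n_Nmix jN.
have hn0 : h != 0 by rewrite gt_eqF.
have hJ := loc_bounded_meas_unit_cell.
have hc c : comp_supp_meas (cspline p r c) := comp_supp_cspline p r c.
have hm k : comp_supp_meas (mixed_dspline k).
  by apply: comp_supp_measB => //; exact: comp_supp_measB.
have hcc c k : comp_supp_meas (fun y => unit_cell y * (cspline p r c y * mixed_dspline k y)).
  by apply: comp_supp_measM => //; apply: comp_supp_measM => //; have [] := hc c.
have hmm : comp_supp_meas (fun y => unit_cell y * (mixed_dspline i y * mixed_dspline j y)).
  by apply: comp_supp_measM => //; apply: comp_supp_measM => //; have [] := hm i.
have -> : @Xmat R p r n i j =
    h ^+ (2 * r) / h * Int (fun y => unit_cell y * (mixed_dspline i y * mixed_dspline j y)).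
  pose G y := h ^+ (2 * r) * (unit_cell y * (mixed_dspline i y * mixed_dspline j y)).
  have hG : comp_supp_meas G.
    apply: comp_supp_measM => //; split; first exact: measurable_cst.
    by move=> L; exists `|h ^+ (2 * r)|.
  rewrite mulrAC -(IntZ _ hmm) mulrC -[X in X^-1 * _](gtr0_norm h0).
  rewrite -(Int_affine 0 hn0 hG) /Xmat Rintegral_mkcond.
  (* The derivative formula is available only inside ]0, 1[ and off [li] and [lj], so the endpoints
     join the exceptional points. *)
  apply: (@Int_eq_off _ _ _ (li ++ lj ++ [:: 0; 1])).
    by have [[]] := comp_supp_meas_affine 0 hn0 hG.
  move=> x; rewrite !mem_cat !in_cons in_nil orbF !negb_or => /and3P[xi xj /andP[x0 x1]].
  rewrite addr0 /G patchE.
  have [xlt|xgt|/eqP] := ltgtP x 0; last by rewrite (negbTE x0).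
    rewrite unit_cell_lt ?pmulr_rlt0 // mul0r mulr0 ifF //.
    by apply/negbTE; rewrite notin_setE /= in_itv /= leNgt xlt.
  have [x1lt|x1gt|/eqP] := ltgtP x 1; last by rewrite (negbTE x1).
    rewrite unit_cell_in ?mulr_ge0 ?gtr_pMr ?ltW ?gtr_pMr //.
    rewrite ifT; last by rewrite inE /= in_itv /= !ltW.
    by rewrite Hi ?xgt // Hj ?xgt // mul1r mulrACA -exprD addnn -mul2n.
  rewrite unit_cell_gt ?ltr_pMr // mul0r mulr0 ifF //.
  by apply/negbTE; rewrite notin_setE /= in_itv /= => /andP[_]; rewrite leNgt x1gt.
congr (_ * _).
rewrite (@Int_mixed unit_cell) //.
have hK c k : Int (fun y => unit_cell y * (cspline p r c y * mixed_dspline k y)) =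
    K c k%:R - (K c (- k%:R) - K c (M - k%:R)).
  rewrite /K !(wgram_sym p r unit_cell c) /wgram.
  rewrite -(@Int_mixed unit_cell); try exact: comp_supp_wgram.
  by apply: eq_Rintegral => y _; rewrite [cspline p r c y * _]mulrC.
by rewrite !hK.
Qed.

Let J0 := loc_bounded_meas_unit_cell.

Let JS S : loc_bounded_meas (fun y => unit_cell (S - y)).
Proof.
have := loc_bounded_meas_affine (-1) S J0.
by congr loc_bounded_meas; apply/funext => y; rewrite mulN1r addrC.
Qed.

(* The reflections of the cell [0, h] in 0 and in h = M / 2 tile [- h, M] with it,
   and this interval contains the support of every product occurring below. *)
Lemma wgram_fold i j : (0 < i <= n)%N -> (0 < j <= n)%N ->
  let K := W unit_cell in
  [/\ K i%:R j%:R + K (- i%:R) (- j%:R) + K (M - i%:R) (M - j%:R) =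
        gram p r (i%:R - p.+1%:R / 2) (j%:R - p.+1%:R / 2),
      K i%:R (- j%:R) + K (- i%:R) j%:R =
        gram p r (i%:R - p.+1%:R / 2) (- j%:R - p.+1%:R / 2),
      K i%:R (M - j%:R) + K (M - i%:R) j%:R =
        gram p r (i%:R - p.+1%:R / 2) (M - j%:R - p.+1%:R / 2),
      K (- i%:R) (M - j%:R) = 0 & K (M - i%:R) (- j%:R) = 0].
Proof.
move=> /andP[i0 iN] /andP[j0 jN] K.
have i1 : 1 <= i%:R :> R by rewrite ler1n.
have in' : i%:R <= n%:R :> R by rewrite ler_nat.
have j1 : 1 <= j%:R :> R by rewrite ler1n.
have jn' : j%:R <= n%:R :> R by rewrite ler_nat.
have := nR; have := ME; have := p0 => P0 HM HN.
have E0 c d : K (- c) (- d) = W (fun y => unit_cell (0 - y)) c d.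
  by rewrite /K -(sub0r c) -(sub0r d) (wgram_reflect rp).
have EM c d : K (M - c) (M - d) = W (fun y => unit_cell (M - y)) c d.
  by rewrite /K (wgram_reflect rp).
(* Writing j as M - (M - j), and below as - - j, brings the mixed terms into the shape of the
   reflection formulas. *)
have EM' : K (M - i%:R) j%:R = K (M - i%:R) (M - (M - j%:R)) by rewrite subKr.
have E0' : K (- i%:R) j%:R = K (- i%:R) (- - j%:R) by rewrite opprK.
have J01 := loc_bounded_measD J0 (JS 0).
split.
- rewrite E0 EM /K !wgramD //.
  (* At 0 and at h two cells overlap and the total weight is 2. *)
  apply: (@wgram1 _ _ _ _ _ _ [:: 0; h]) => y.
  rewrite !in_cons in_nil orbF negb_or => /andP[y0 yh].
  have [y1|y1] := ltP y (- h).
    by rewrite cspline_lt ?mul0r ?mulr0 //; lra.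
  have [y2|y2|/eqP] := ltgtP y 0; last by rewrite (negbTE y0).
    rewrite (@unit_cell_lt y) // (@unit_cell_in (0 - y)) ?(@unit_cell_gt (M - y)); try lra.
  have [y3|y3|/eqP] := ltgtP y h; last by rewrite (negbTE yh).
    rewrite (@unit_cell_in y) ?(@unit_cell_lt (0 - y)) ?(@unit_cell_gt (M - y)); try lra.
  have [y4|y4] := leP y M.
    rewrite (@unit_cell_gt y) ?(@unit_cell_lt (0 - y)) ?(@unit_cell_in (M - y)); try lra.
  by rewrite cspline_ge ?mul0r ?mulr0 //; lra.
(* The spline at i vanishes left of -h and the one at -j right of h, so the cell and its reflection
   in 0 suffice. *)
- rewrite E0' E0 /K !wgramD //.
  apply: (@wgram1 _ _ _ _ _ _ [:: 0]) => y; rewrite in_cons in_nil orbF => y0.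
  have [y1|y1] := ltP y (- h).
    by rewrite cspline_lt ?mul0r ?mulr0 //; lra.
  have [y2|y2|/eqP] := ltgtP y 0; last by rewrite (negbTE y0).
    rewrite (@unit_cell_lt y) // (@unit_cell_in (0 - y)); try lra.
  have [y3|y3] := leP y h.
    rewrite (@unit_cell_in y) ?(@unit_cell_lt (0 - y)); try lra.
  by rewrite [X in _ * X]mulrC cspline_ge ?mul0r ?mulr0 //; lra.
(* The spline at M - j vanishes left of 0 and the one at i right of M, so the cell and its
   reflection in h suffice. *)
- rewrite EM' EM /K !wgramD //.
  apply: (@wgram1 _ _ _ _ _ _ [:: h]) => y; rewrite in_cons in_nil orbF => yh.
  have [y1|y1] := ltP y 0.
    by rewrite (mulrC (cspline p r i%:R y)) cspline_lt ?mul0r ?mulr0 //; lra.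
  have [y3|y3|/eqP] := ltgtP y h; last by rewrite (negbTE yh).
    rewrite (@unit_cell_in y) ?(@unit_cell_gt (M - y)); try lra.
  have [y4|y4] := leP y M.
    rewrite (@unit_cell_gt y) ?(@unit_cell_in (M - y)); try lra.
  by rewrite cspline_ge ?mul0r ?mulr0 //; lra.
(* Disjoint supports: the centres are M + i - j >= n + 2 > p + 1 apart. *)
- by apply: wgram0; lra.
- by rewrite /K wgram_sym; apply: wgram0; lra.
Qed.

End MixedBasis.

(** * Assembly of the Toeplitz and Hankel entries *)

Theorem mainTheorem10 (R : realType) (p n r : nat) :
  (1 <= p)%N -> (1 <= n)%N -> (r <= p)%N ->
  (maxn p.+1 (p + p./2) <= n)%N ->
  forall i j : 'I_n,
    @Xmat R p r n i.+1 j.+1 =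
    ((2 * n + 1)%:R / 2) ^ ((2 * r)%:Z - 1)
      * (@Tmat R p r n i.+1 j.+1 + @Hmat R p r n i.+1 j.+1).
Proof.
move=> _ _ rp; rewrite geq_max => /andP[pn _] i j.
have iN : (0 < i.+1 <= n)%N by rewrite /= ltn_ord.
have jN : (0 < j.+1 <= n)%N by rewrite /= ltn_ord.
have h0 : (2 * n + 1)%:R / 2 != 0 :> R by rewrite mulf_neq0 // ?invr_eq0 ?pnatr_eq0 ?addn1.
rewrite (Xmat_wgram _ pn iN jN) // expfzDr // exprN1.
have [E1 E2 E3 E4 E5] := @wgram_fold R p n r rp pn _ _ iN jN.
congr (_ * _).
have -> : @Tmat R p r n i.+1 j.+1 =
    gram p r (i.+1%:R - p.+1%:R / 2) (j.+1%:R - p.+1%:R / 2).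
  rewrite /Tmat; case: ifPn => [ij|]; last rewrite -ltnNge => /ltnW ij.
    (* The centres are swapped so that their difference is a natural number. *)
    by rewrite gramC (@gram_alpha _ _ _ rp _ _ (j.+1 - i.+1)) // natrB //; ring.
  by rewrite (@gram_alpha _ _ _ rp _ _ (i.+1 - j.+1)) // natrB //; ring.
have -> : @Hmat R p r n i.+1 j.+1 =
    - gram p r (i.+1%:R - p.+1%:R / 2) (- j.+1%:R - p.+1%:R / 2) +
    gram p r (i.+1%:R - p.+1%:R / 2) ((2 * n + 1)%:R - j.+1%:R - p.+1%:R / 2).
  rewrite /Hmat (@gram_alpha _ _ _ rp _ _ (i.+1 + j.+1)); last by rewrite natrD; ring.
  rewrite [in RHS]gramC (@gram_alpha _ _ _ rp _ _ (2 * n + 1 - i.+1 - j.+1)) //.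
  by rewrite !natrB; [ring|lia|lia].
(* Of the nine products, the three with like centres give alpha_|i-j|, the pair joining i and -j
   enters with a minus sign as -alpha_(i+j), and the pair joining i and M - j gives
   alpha_(2n+1-i-j). *)
rewrite -E1 -E2 -E3 E4 E5; ring.
Qed.
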